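(* Let $\mathcal C$ be a finite tensor category and let $\mathcal M$ and $\mathcal N$ be exact left $\mathcal C$-module categories. There are natural isomorphisms $$\underline{\mathrm{Nat}}_{(\mathcal M,\mathcal N)}(H,H')\;\cong\;\Phi_{\mathcal M}^{\mathrm{ra}}(H^{\mathrm{ra}}\circ H')\;\cong\;\Psi_{\mathcal N}^{\mathrm{ra}}(H'\circ H^{\mathrm{la}})$$ in $\mathcal Z(\mathcal C)$, for $H,H'\in\mathrm{Fun}_{\mathcal C}(\mathcal M,\mathcal N)$.
   Context: Work over an algebraically closed field $\Bbbk$. A finite tensor category is a finite $\Bbbk$-linear abelian rigid monoidal category with bilinear tensor product and $\mathrm{End}(\mathbb 1)\cong\Bbbk$. A $\mathcal C$-module category (finite $\Bbbk$-linear category with $\mathcal C$-action exact in each variable) is exact if $p\triangleright m$ is projective for every projective $p\in\mathcal C$ and all $m$. $\mathrm{Fun}_{\mathcal C}(\mathcal M,\mathcal N)$ is the category of $\mathcal C$-module functors and module natural transformations; $\mathcal C^*_{\mathcal N}=\mathrm{Fun}_{\mathcal C}(\mathcal N,\mathcal N)$ with composition as tensor product, and $\overline{\mathcal A}$ denotes $\mathcal A$ with reversed tensor product. $(-)^{\mathrm{la}},(-)^{\mathrm{ra}}$ denote left and right adjoints (adjoints of $\mathcal C$-module functors are $\mathcal C$-module functors). $\mathcal Z(\mathcal C)$ is the Drinfeld center, with objects $(c,\nu)$, $\nu_x\colon c\otimes x\cong x\otimes c$. $\Psi_{\mathcal N}\colon\mathcal Z(\mathcal C)\to\mathcal C^*_{\mathcal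 N}$ is the tensor functor $(c,\nu)\mapsto c\triangleright-$, where $c\triangleright-$ is a $\mathcal C$-module functor via $\nu$, with tensor structure given by the associativity constraints of $\mathcal N$. $\Phi_{\mathcal M}\colon\mathcal Z(\mathcal C)\to\overline{\mathcal C^*_{\mathcal M}}$ is given by the same assignment for $\mathcal M$, with tensor structure $c\triangleright(d\triangleright m)\cong(c\otimes d)\triangleright m\xrightarrow{\nu_d}(d\otimes c)\triangleright m$. $\mathrm{Fun}_{\mathcal C}(\mathcal M,\mathcal N)$ is a $\mathcal Z(\mathcal C)$-module category via $(c,\nu)\triangleright H=c\triangleright H(-)$ (equivalently, up to equivalence of module categories, $H(c\triangleright-)$). The object of internal natural transformations $\underline{\mathrm{Nat}}_{(\mathcal M,\mathcal N)}(H,H')\in\mathcal Z(\mathcal C)$ is the internal Hom of this module category: $\mathrm{Hom}_{\mathrm{Fun}_{\mathcal C}(\mathcal M,\mathcal N)}(z\triangleright H,H')\cong\mathrm{Hom}_{\mathcal Z(\mathcal C)}(z,\underline{\mathrm{Nat}}_{(\mathcal M,\mathcal N)}(H,H'))$ naturally in $z\in\mathcal Z(\mathcal C)$. *)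

(* Defs.v *)
From HB Require Import structures.
From mathcomp Require Import all_boot all_algebra.
From Stdlib Require Import FunctionalExtensionality ProofIrrelevance.

Set Implicit Arguments.
Unset Strict Implicit.
Unset Printing Implicit Defensive.

Import GRing.Theory.
Local Open Scope ring_scope.

#[local] Obligation Tactic := intros; simpl.

Declare Scope cat_scope.
Delimit Scope cat_scope with cat.

Record category := Category {
  ob :> Type;
  hom : ob -> ob -> Type;
  idm : forall x, hom x x;
  comp : forall x y z, hom y z -> hom x y -> hom x z;
  comp1m : forall x y (f : hom x y), comp (idm y) f = f;
  compm1 : forall x y (f : hom x y), comp f (idm x) = f;
  compA : forall w x y z (h : hom y z) (g : hom x y) (f : hom w x),
    comp h (comp g f) = comp (comp h g) f
}.
Arguments hom {c} _ _ : simpl never.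
Arguments idm {c} _ : simpl never.
Arguments comp {c x y z} _ _ : simpl never.

Notation "g ∘ f" := (comp g f) (at level 40, left associativity) : cat_scope.
Local Open Scope cat_scope.

Record iso (A : category) (x y : A) := Iso {
  fwd :> hom x y;
  bwd : hom y x;
  fwdK : bwd ∘ fwd = idm x;
  bwdK : fwd ∘ bwd = idm y
}.

Definition mono (A : category) (x y : A) (f : hom x y) : Prop :=
  forall w (g h : hom w x), f ∘ g = f ∘ h -> g = h.

Definition epi (A : category) (x y : A) (f : hom x y) : Prop :=
  forall z (g h : hom y z), g ∘ f = h ∘ f -> g = h.

Definition projective (A : category) (p : A) : Prop :=
  forall (x y : A) (e : hom x y), epi e ->
  forall f : hom p y, exists g : hom p x, e ∘ g = f.

Record functor (A B : category) := Functor {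
  fob :> A -> B;
  fhom : forall x y, hom x y -> hom (fob x) (fob y);
  fhom1 : forall x, fhom (idm x) = idm (fob x);
  fhomM : forall x y z (g : hom y z) (f : hom x y),
    fhom (g ∘ f) = fhom g ∘ fhom f
}.
Arguments fhom {A B} _ {x y} _.

Definition functor_id (A : category) : functor A A :=
  @Functor A A (fun x => x) (fun x y f => f) (fun x => erefl)
    (fun x y z g f => erefl).

Program Definition functor_comp (A B D : category)
    (G : functor B D) (F : functor A B) : functor A D :=
  @Functor A D (fun x => G (F x)) (fun x y f => fhom G (fhom F f)) _ _.
Next Obligation. by rewrite !fhom1. Qed.
Next Obligation. by rewrite !fhomM. Qed.

Record nat_trans (A B : category) (F G : functor A B) := NatTrans {
  ntc :> forall x, hom (F x) (G x);
  nt_nat : forall x y (f : hom x y), ntc y ∘ fhom F f = fhom G f ∘ ntc x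
}.

Record adjunction (A B : category) (F : functor A B) (G : functor B A) :=
  Adjunction {
    adj_unit : nat_trans (functor_id A) (functor_comp G F);
    adj_counit : nat_trans (functor_comp F G) (functor_id B);
    adj_triangle_l : forall x : A,
      adj_counit (F x) ∘ fhom F (adj_unit x) = idm (F x);
    adj_triangle_r : forall y : B,
      fhom G (adj_counit y) ∘ adj_unit (G y) = idm (G y)
  }.

Record right_adjoint (A B : category) (F : functor A B) := RightAdjoint {
  radj :> functor B A;
  radj_adj : adjunction F radj
}.

(* Morphism spaces in [vectType k] are finite-dimensional. *)
Record linear_category (k : fieldType) := LinearCategory {
  lob : Type;
  lhom : lob -> lob -> vectType k;
  lidm : forall x, lhom x x;
  lcomp : forall x y z, lhom y z -> lhom x y -> lhom x z;
  lcomp1m : forall x y (f : lhom x y), lcomp (lidm y) f = f;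
  lcompm1 : forall x y (f : lhom x y), lcomp f (lidm x) = f;
  lcompA : forall w x y z (h : lhom y z) (g : lhom x y) (f : lhom w x),
    lcomp h (lcomp g f) = lcomp (lcomp h g) f;
  lcomp_linearl : forall x y z (f : lhom x y),
    linear (fun g : lhom y z => lcomp g f);
  lcomp_linearr : forall x y z (g : lhom y z),
    linear (fun f : lhom x y => lcomp g f)
}.

Definition lcat (k : fieldType) (A : linear_category k) : category :=
  @Category (lob A) (fun x y => lhom x y) (@lidm k A) (@lcomp k A)
    (@lcomp1m k A) (@lcompm1 k A) (@lcompA k A).
Coercion lcat : linear_category >-> category.

Section Linear.
Variable k : fieldType.

Definition linear_functor (A B : linear_category k) (F : functor A B) : Prop :=
  forall x y : A, linear (fun f : lhom x y => fhom F f : lhom (F x) (F y)).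

Section Abelian.
Variable A : linear_category k.

Definition zerom (x y : A) : hom x y := (0 : lhom x y).

Definition zero_object (z : A) : Prop :=
  forall x : A, (forall f : hom x z, f = zerom x z) /\
                (forall f : hom z x, f = zerom z x).

Definition is_biproduct (x y s : A) : Prop :=
  exists (i1 : hom x s) (i2 : hom y s) (p1 : hom s x) (p2 : hom s y),
    [/\ p1 ∘ i1 = idm x, p2 ∘ i2 = idm y, p2 ∘ i1 = zerom x y,
        p1 ∘ i2 = zerom y x &
        (i1 ∘ p1 : lhom s s) + (i2 ∘ p2 : lhom s s) = idm s].

Definition is_kernel (w x y : A) (i : hom w x) (f : hom x y) : Prop :=
  f ∘ i = zerom w y /\
  forall v (g : hom v x), f ∘ g = zerom v y -> exists! u : hom v w, i ∘ u = g.

Definition is_cokernel (x y z : A) (p : hom y z) (f : hom x y) : Prop :=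
  p ∘ f = zerom x z /\
  forall v (g : hom y v), g ∘ f = zerom x v -> exists! u : hom z v, u ∘ p = g.

Definition short_exact (x y z : A) (i : hom x y) (p : hom y z) : Prop :=
  is_kernel i p /\ is_cokernel p i.

Record abelian : Prop := Abelian {
  abelian_zero : exists z : A, zero_object z;
  abelian_biproduct : forall x y : A, exists s, is_biproduct x y s;
  abelian_kernel : forall (x y : A) (f : hom x y),
    exists (w : A) (i : hom w x), is_kernel i f;
  abelian_cokernel : forall (x y : A) (f : hom x y),
    exists (z : A) (p : hom y z), is_cokernel p f;
  abelian_mono : forall (x y : A) (f : hom x y), mono f ->
    exists (z : A) (g : hom y z), is_kernel f g;
  abelian_epi : forall (x y : A) (f : hom x y), epi f ->
    exists (w : A) (g : hom w x), is_cokernel f g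
}.

Definition simple (s : A) : Prop :=
  ~ zero_object s /\
  forall (x : A) (i : hom x s), mono i ->
    zero_object x \/ exists j : iso x s, fwd j = i.

Inductive finite_length : A -> Prop :=
| finite_length0 x : zero_object x -> finite_length x
| finite_lengthS x y s (i : hom x y) (p : hom y s) :
    finite_length x -> simple s -> short_exact i p -> finite_length y.

(* The remaining finiteness condition, finite-dimensionality of the spaces of
   morphisms, is part of [linear_category]. *)
Record finite_category : Prop := FiniteCategory {
  finite_abelian : abelian;
  finite_finite_length : forall x : A, finite_length x;
  finite_enough_projectives : forall x : A,
    exists (p : A) (e : hom p x), projective p /\ epi e;
  finite_simples : exists (n : nat) (t : 'I_n -> A),
    forall s : A, simple s -> exists i, inhabited (iso s (t i))
}.

End Abelian.

Definition exact_functor (A B : linear_category k) (F : functor A B) : Prop :=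
  forall (x y z : A) (i : hom x y) (p : hom y z),
    short_exact i p -> short_exact (fhom F i) (fhom F p).

Record monoidal_linear_category := MonoidalLinearCategory {
  mlc_cat :> linear_category k;
  one : mlc_cat;
  tens : mlc_cat -> mlc_cat -> mlc_cat;
  tensm : forall c c' d d' : mlc_cat,
    hom c c' -> hom d d' -> hom (tens c d) (tens c' d');
  tensm1 : forall c d, tensm (idm c) (idm d) = idm (tens c d);
  tensmM : forall c c' c'' d d' d'' (f' : hom c' c'') (f : hom c c')
    (g' : hom d' d'') (g : hom d d'),
    tensm (f' ∘ f) (g' ∘ g) = tensm f' g' ∘ tensm f g;
  tensm_linearl : forall (c c' d d' : mlc_cat) (g : hom d d'),
    linear (fun f : lhom c c' => tensm f g : lhom (tens c d) (tens c' d'));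
  tensm_linearr : forall (c c' d d' : mlc_cat) (f : hom c c'),
    linear (fun g : lhom d d' => tensm f g : lhom (tens c d) (tens c' d'));
  assoc : forall x y z, iso (tens (tens x y) z) (tens x (tens y z));
  lunit : forall x, iso (tens one x) x;
  runit : forall x, iso (tens x one) x;
  assoc_nat : forall x x' y y' z z' (f : hom x x') (g : hom y y') (h : hom z z'),
    assoc x' y' z' ∘ tensm (tensm f g) h = tensm f (tensm g h) ∘ assoc x y z;
  lunit_nat : forall x x' (f : hom x x'),
    lunit x' ∘ tensm (idm one) f = f ∘ lunit x;
  runit_nat : forall x x' (f : hom x x'),
    runit x' ∘ tensm f (idm one) = f ∘ runit x;
  tens_pentagon : forall w x y z,
    assoc w x (tens y z) ∘ assoc (tens w x) y z =
    tensm (idm w) (assoc x y z) ∘ assoc w (tens x y) z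
      ∘ tensm (assoc w x y) (idm z);
  tens_triangle : forall x y,
    tensm (idm x) (lunit y) ∘ assoc x one y = tensm (runit x) (idm y)
}.

End Linear.

Arguments one {k m}.
Arguments tens {k m} _ _.
Arguments tensm {k m c c' d d'} _ _.
Arguments assoc {k m} _ _ _.
Arguments lunit {k m} _.
Arguments runit {k m} _.

Notation "x ⊗ y" := (tens x y) (at level 35, right associativity) : cat_scope.
Notation "f ⊗' g" := (tensm f g) (at level 35, right associativity) : cat_scope.

Section TensorCategory.
Variables (k : fieldType) (C : monoidal_linear_category k).

Definition is_left_dual (d x : C) : Prop :=
  exists (ev : hom (d ⊗ x) one) (coev : hom one (x ⊗ d)),
    runit x ∘ (idm x ⊗' ev) ∘ assoc x d x ∘ (coev ⊗' idm x)
      ∘ bwd (lunit x) = idm x /\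
    lunit d ∘ (ev ⊗' idm d) ∘ bwd (assoc d x d) ∘ (idm d ⊗' coev)
      ∘ bwd (runit d) = idm d.

(* [is_left_dual x d] says that [d] is a right dual of [x]. *)
Definition rigid : Prop :=
  forall x : C, (exists d, is_left_dual d x) /\ (exists d, is_left_dual x d).

Definition finite_tensor_category : Prop :=
  [/\ finite_category C, rigid &
      forall f : lhom (one : C) one, exists! a : k, f = a *: lidm one].

End TensorCategory.

Record linear_module_category (k : fieldType)
    (C : monoidal_linear_category k) := LinearModuleCategory {
  lmc_cat :> linear_category k;
  act : C -> lmc_cat -> lmc_cat;
  actm : forall (c c' : C) (m m' : lmc_cat),
    hom c c' -> hom m m' -> hom (act c m) (act c' m');
  actm1 : forall c m, actm (idm c) (idm m) = idm (act c m);
  actmM : forall c c' c'' m m' m'' (f' : hom c' c'') (f : hom c c')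
    (g' : hom m' m'') (g : hom m m'),
    actm (f' ∘ f) (g' ∘ g) = actm f' g' ∘ actm f g;
  actm_linearl : forall (c c' : C) (m m' : lmc_cat) (g : hom m m'),
    linear (fun f : lhom c c' => actm f g : lhom (act c m) (act c' m'));
  actm_linearr : forall (c c' : C) (m m' : lmc_cat) (f : hom c c'),
    linear (fun g : lhom m m' => actm f g : lhom (act c m) (act c' m'));
  massoc : forall x y m, iso (act (x ⊗ y) m) (act x (act y m));
  munit : forall m, iso (act one m) m;
  massoc_nat : forall x x' y y' m m' (f : hom x x') (g : hom y y')
    (h : hom m m'),
    massoc x' y' m' ∘ actm (f ⊗' g) h = actm f (actm g h) ∘ massoc x y m;
  munit_nat : forall m m' (f : hom m m'),
    munit m' ∘ actm (idm one) f = f ∘ munit m;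
  act_pentagon : forall x y z m,
    massoc x y (act z m) ∘ massoc (x ⊗ y) z m =
    actm (idm x) (massoc y z m) ∘ massoc x (y ⊗ z) m
      ∘ actm (assoc x y z) (idm m);
  act_triangle : forall x m,
    actm (idm x) (munit m) ∘ massoc x one m = actm (runit x) (idm m)
}.
Arguments act {k C l} _ _.
Arguments actm {k C l c c' m m'} _ _.
Arguments massoc {k C l} _ _ _.
Arguments munit {k C l} _.

Notation "c ▷ m" := (act c m) (at level 35, right associativity) : cat_scope.
Notation "f ▷' g" := (actm f g) (at level 35, right associativity) : cat_scope.

Section ModuleCategory.
Variables (k : fieldType) (C : monoidal_linear_category k).

Section ExactModule.
Variable M : linear_module_category C.

Program Definition act_functorl (m : M) : functor C M :=
  @Functor C M (fun c => c ▷ m) (fun c d f => f ▷' idm m) _ _.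
Next Obligation. exact: actm1. Qed.
Next Obligation. by rewrite -actmM comp1m. Qed.

Program Definition act_functorr (c : C) : functor M M :=
  @Functor M M (fun m => c ▷ m) (fun m n f => idm c ▷' f) _ _.
Next Obligation. exact: actm1. Qed.
Next Obligation. by rewrite -actmM comp1m. Qed.

Definition finite_module_category : Prop :=
  [/\ finite_category M,
      forall m, exact_functor (act_functorl m) &
      forall c, exact_functor (act_functorr c)].

Definition exact_module_category : Prop :=
  finite_module_category /\
  forall (p : C) (m : M), projective p -> projective (p ▷ m).

End ExactModule.

Definition regular_module : linear_module_category C :=
  @LinearModuleCategory k C C tens (@tensm k C) (@tensm1 k C) (@tensmM k C)
    (@tensm_linearl k C) (@tensm_linearr k C) assoc lunit (@assoc_nat k C)
    (@lunit_nat k C) (@tens_pentagon k C) (@tens_triangle k C).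

Lemma iso_epi (A : category) (x y : A) (i : iso x y) : epi i.
Proof.
by move=> z g h E; rewrite -(compm1 g) -(compm1 h) -(bwdK i) !compA E.
Qed.

Lemma iso_mono (A : category) (x y : A) (i : iso x y) : mono i.
Proof.
by move=> w g h E; rewrite -(comp1m g) -(comp1m h) -(fwdK i) -!compA E.
Qed.

Program Definition iso_sym (A : category) (x y : A) (i : iso x y) : iso y x :=
  @Iso A y x (bwd i) (fwd i) _ _.
Next Obligation. exact: bwdK. Qed.
Next Obligation. exact: fwdK. Qed.

Program Definition iso_comp (A : category) (x y z : A)
    (j : iso y z) (i : iso x y) : iso x z :=
  @Iso A x z (j ∘ i) (bwd i ∘ bwd j) _ _.
Next Obligation. by rewrite compA -(compA _ _ j) fwdK compm1 fwdK. Qed.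
Next Obligation. by rewrite compA -(compA _ _ (bwd i)) bwdK compm1 bwdK. Qed.

Program Definition iso_act (M : linear_module_category C) (c d : C) (m n : M)
    (i : iso c d) (j : iso m n) : iso (c ▷ m) (d ▷ n) :=
  @Iso M _ _ (i ▷' j) (bwd i ▷' bwd j) _ _.
Next Obligation. by rewrite -actmM !fwdK actm1. Qed.
Next Obligation. by rewrite -actmM !bwdK actm1. Qed.

Program Definition iso_id (A : category) (x : A) : iso x x :=
  @Iso A x x (idm x) (idm x) _ _.
Next Obligation. exact: comp1m. Qed.
Next Obligation. exact: comp1m. Qed.

Lemma actm_compr (M : linear_module_category C) c (m n p : M)
    (g : hom n p) (f : hom m n) :
  idm c ▷' (g ∘ f) = (idm c ▷' g) ∘ (idm c ▷' f).
Proof. by rewrite -actmM comp1m. Qed.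

Lemma actm_compl (M : linear_module_category C) (c d e : C) (m : M)
    (g : hom d e) (f : hom c d) :
  (g ∘ f) ▷' idm m = (g ▷' idm m) ∘ (f ▷' idm m).
Proof. by rewrite -actmM comp1m. Qed.

(* The analogue for module categories of Kelly's redundancy of the second
   unit axiom of a monoidal category. *)
Lemma munit_massoc (M : linear_module_category C) (x : C) (m : M) :
  munit (x ▷ m) ∘ massoc one x m = lunit x ▷' idm m.
Proof.
have faith (p q : M) (f g : hom p q) :
    idm (one : C) ▷' f = idm one ▷' g -> f = g.
  by move=> E; apply: (iso_epi (i := munit p)); rewrite -!munit_nat E.
apply: faith.
apply: (iso_epi (i := massoc one (one ⊗ x) m)).
apply: (iso_epi (i := iso_act (assoc one one x) (iso_id m))) => /=.
rewrite actm_compr -!compA (compA _ (massoc _ _ _)) -act_pentagon.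
rewrite compA act_triangle -(actm1 x m) -massoc_nat.
rewrite -tens_triangle actm_compl compA massoc_nat.
by rewrite -!compA.
Qed.

Record module_functor (M N : linear_module_category C) := ModuleFunctor {
  mf_fun :> functor M N;
  mf_linear : linear_functor mf_fun;
  mf_str : forall (x : C) (m : M), iso (mf_fun (x ▷ m)) (x ▷ mf_fun m);
  mf_str_nat : forall (x x' : C) (m m' : M) (f : hom x x') (g : hom m m'),
    mf_str x' m' ∘ fhom mf_fun (f ▷' g) = (f ▷' fhom mf_fun g) ∘ mf_str x m;
  mf_pentagon : forall (x y : C) (m : M),
    massoc x y (mf_fun m) ∘ mf_str (x ⊗ y) m =
    (idm x ▷' mf_str y m) ∘ mf_str x (y ▷ m) ∘ fhom mf_fun (massoc x y m);
  mf_triangle : forall m : M,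
    munit (mf_fun m) ∘ mf_str one m = fhom mf_fun (munit m)
}.

Record module_nat_trans (M N : linear_module_category C)
    (H K : module_functor M N) := ModuleNatTrans {
  mnt_nt :> nat_trans H K;
  mnt_str : forall (x : C) (m : M),
    mf_str K x m ∘ mnt_nt (x ▷ m) = (idm x ▷' mnt_nt m) ∘ mf_str H x m
}.

Lemma mnt_eq (M N : linear_module_category C) (H K : module_functor M N)
    (s t : module_nat_trans H K) : (forall m, s m = t m) -> s = t.
Proof.
case: s t => [[s s1] s2] [[t t1] t2] /= E.
have {}E : s = t by apply: functional_extensionality_dep.
subst t; have ? := proof_irrelevance _ s1 t1; subst t1.
by congr ModuleNatTrans; apply: proof_irrelevance.
Qed.

Definition mnt_build (M N : linear_module_category C) (H K : module_functor M N)
    (t : forall m, hom (H m) (K m))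
    (t_nat : forall m n (f : hom m n), t n ∘ fhom H f = fhom K f ∘ t m)
    (t_str : forall (x : C) (m : M),
       mf_str K x m ∘ t (x ▷ m) = (idm x ▷' t m) ∘ mf_str H x m) :
  module_nat_trans H K := @ModuleNatTrans M N H K (NatTrans t_nat) t_str.
Arguments mnt_build {M N} H K t t_nat t_str.

Section FunCat.
Variables M N : linear_module_category C.

Program Definition mnt_id (H : module_functor M N) : module_nat_trans H H :=
  mnt_build H H (fun m => idm (H m)) _ _.
Next Obligation. by rewrite comp1m compm1. Qed.
Next Obligation. by rewrite actm1 comp1m compm1. Qed.

Program Definition mnt_comp (H K L : module_functor M N)
    (t : module_nat_trans K L) (s : module_nat_trans H K) :
    module_nat_trans H L :=
  mnt_build H L (fun m => t m ∘ s m) _ _.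
Next Obligation. by rewrite -compA nt_nat !compA nt_nat. Qed.
Next Obligation. by rewrite compA mnt_str -compA mnt_str actm_compr compA. Qed.

Program Definition module_fun_cat : category :=
  @Category (module_functor M N) (@module_nat_trans M N) mnt_id mnt_comp _ _ _.
Next Obligation. by apply: mnt_eq => m /=; rewrite comp1m. Qed.
Next Obligation. by apply: mnt_eq => m /=; rewrite compm1. Qed.
Next Obligation. by apply: mnt_eq => m /=; rewrite compA. Qed.

End FunCat.

Program Definition mf_id (M : linear_module_category C) : module_functor M M :=
  @ModuleFunctor M M (functor_id M) _ (fun x m => iso_id (x ▷ m)) _ _ _.
Next Obligation. by []. Qed.
Next Obligation. by rewrite comp1m compm1. Qed.
Next Obligation. by rewrite actm1 !comp1m compm1. Qed.
Next Obligation. by rewrite compm1. Qed.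

Program Definition iso_fun (A B : category) (F : functor A B) (x y : A)
    (i : iso x y) : iso (F x) (F y) :=
  @Iso B _ _ (fhom F i) (fhom F (bwd i)) _ _.
Next Obligation. by rewrite -fhomM fwdK fhom1. Qed.
Next Obligation. by rewrite -fhomM bwdK fhom1. Qed.

Program Definition mf_comp (M N P : linear_module_category C)
    (G : module_functor N P) (F : module_functor M N) : module_functor M P :=
  @ModuleFunctor M P (functor_comp G F) _
    (fun x m => iso_comp (mf_str G x (F m)) (iso_fun G (mf_str F x m))) _ _ _.
Next Obligation.
move=> x y a f g; refine (etrans _ (@mf_linear _ _ G _ _ a (fhom F f) (fhom F g))).
exact: (congr1 (fun h => fhom G h) (@mf_linear _ _ F x y a f g)).
Qed.
Next Obligation.
by rewrite -compA -fhomM mf_str_nat fhomM compA mf_str_nat compA.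
Qed.
Next Obligation.
rewrite compA mf_pentagon -!compA -fhomM mf_pentagon !fhomM actm_compr.
by rewrite !compA -[in RHS](compA _ _ (mf_str G x _)) -mf_str_nat !compA.
Qed.
Next Obligation. by rewrite compA mf_triangle -fhomM mf_triangle. Qed.

Program Definition mnt_hcomp (M N P : linear_module_category C)
    (G G' : module_functor N P) (F F' : module_functor M N)
    (t : module_nat_trans G G') (s : module_nat_trans F F') :
    module_nat_trans (mf_comp G F) (mf_comp G' F') :=
  mnt_build (mf_comp G F) (mf_comp G' F')
    (fun m => t (F' m) ∘ fhom G (s m)) _ _.
Next Obligation. by rewrite -compA -fhomM (nt_nat s) fhomM !compA (nt_nat t). Qed.
Next Obligation.
rewrite -compA (compA (fhom G' _)) -(nt_nat t) -(compA (t _)) -fhomM.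
rewrite (mnt_str s) fhomM !compA (mnt_str t) actm_compr.
by rewrite -(compA _ (mf_str G _ _)) mf_str_nat !compA.
Qed.

(* Adjunctions in the 2-category of module categories: unit and counit are
   module natural transformations.  The module structure on an adjoint of a
   module functor is the (unique) one for which this holds. *)
Record module_adjunction (M N : linear_module_category C)
    (F : module_functor M N) (G : module_functor N M) := ModuleAdjunction {
  madj_unit : module_nat_trans (mf_id M) (mf_comp G F);
  madj_counit : module_nat_trans (mf_comp F G) (mf_id N);
  madj_triangle_l : forall m : M,
    madj_counit (F m) ∘ fhom F (madj_unit m) = idm (F m);
  madj_triangle_r : forall n : N,
    fhom G (madj_counit n) ∘ madj_unit (G n) = idm (G n)
}.

Record module_right_adjoint (M N : linear_module_category C)
    (H : module_functor M N) := ModuleRightAdjoint {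
  mra :> module_functor N M;
  mra_adj : module_adjunction H mra
}.

Record module_left_adjoint (M N : linear_module_category C)
    (H : module_functor M N) := ModuleLeftAdjoint {
  mla :> module_functor N M;
  mla_adj : module_adjunction mla H
}.

(* H^ra => K^ra K H^ra => K^ra H H^ra => K^ra *)
Program Definition mate_ra (M N : linear_module_category C)
    (H K : module_functor M N)
    (Hra : module_right_adjoint H) (Kra : module_right_adjoint K)
    (t : module_nat_trans K H) : module_nat_trans Hra Kra :=
  mnt_build Hra Kra (fun n =>
    fhom Kra (madj_counit (mra_adj Hra) n) ∘ fhom Kra (t (Hra n))
      ∘ madj_unit (mra_adj Kra) (Hra n)) _ _.
Next Obligation.
rewrite -compA [_ ∘ fhom Hra f](nt_nat (madj_unit (mra_adj Kra)) (fhom Hra f)).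
rewrite /= !compA -!fhomM -!compA (nt_nat t) (compA (madj_counit _ _)).
by rewrite [_ ∘ fhom H _](nt_nat (madj_counit (mra_adj Hra)) f) /= !compA.
Qed.
Next Obligation.
have eta := mnt_str (madj_unit (mra_adj Kra)) x (Hra m).
have eps := mnt_str (madj_counit (mra_adj Hra)) x m.
have nat := nt_nat (madj_unit (mra_adj Kra)) (mf_str Hra x m).
rewrite /= in eta eps nat; rewrite compm1 in eta; rewrite comp1m in eps.
rewrite !actm_compr -compA -eta -!compA nat.
rewrite !compA -(compA _ _ (mf_str Kra _ _)) -mf_str_nat.
rewrite compA -[_ ∘ mf_str Kra _ _]mf_str_nat -!compA; congr (_ ∘ _).
rewrite !compA -!fhomM eps; congr (fhom Kra _ ∘ _).
by rewrite -!compA -(nt_nat t) (compA (mf_str H _ _)) (mnt_str t) !compA.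
Qed.

(* H^la => H^la K K^la => H^la H K^la => K^la *)
Program Definition mate_la (M N : linear_module_category C)
    (H K : module_functor M N)
    (Hla : module_left_adjoint H) (Kla : module_left_adjoint K)
    (t : module_nat_trans K H) : module_nat_trans Hla Kla :=
  mnt_build Hla Kla (fun n =>
    madj_counit (mla_adj Hla) (Kla n) ∘ fhom Hla (t (Kla n))
      ∘ fhom Hla (madj_unit (mla_adj Kla) n)) _ _.
Next Obligation.
rewrite -!compA -!fhomM [_ ∘ f](nt_nat (madj_unit (mla_adj Kla)) f) /=.
rewrite compA (nt_nat t) -compA fhomM compA.
rewrite [_ ∘ fhom Hla (fhom H _)](nt_nat (madj_counit (mla_adj Hla))) /=.
by rewrite fhomM -!compA.
Qed.
Next Obligation.
have eta := mnt_str (madj_unit (mla_adj Kla)) x m.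
have eps := mnt_str (madj_counit (mla_adj Hla)) x (Kla m).
have nat := nt_nat (madj_counit (mla_adj Hla)) (mf_str Kla x m).
rewrite /= in eta eps nat; rewrite compm1 in eta; rewrite comp1m in eps.
rewrite !actm_compr -!compA -mf_str_nat -eta.
rewrite (compA _ (mf_str Hla _ _)) -mf_str_nat.
rewrite !compA -nat eps -!compA; do 2 congr (_ ∘ _).
rewrite -!fhomM; congr (fhom Hla _).
by rewrite !compA -(mnt_str t) -!compA (compA (t _)) (nt_nat t) -!compA.
Qed.

Record center_ob := CenterOb {
  zob :> C;
  hb : forall x : C, iso (zob ⊗ x) (x ⊗ zob);
  hb_nat : forall (x y : C) (f : hom x y),
    hb y ∘ (idm zob ⊗' f) = (f ⊗' idm zob) ∘ hb x;
  hb_hexagon : forall x y : C,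
    assoc x y zob ∘ hb (x ⊗ y) ∘ assoc zob x y =
    (idm x ⊗' hb y) ∘ assoc x zob y ∘ (hb x ⊗' idm y)
}.

Record center_hom (c d : center_ob) := CenterHom {
  zhom :> hom (zob c) (zob d);
  zhom_hb : forall x : C,
    hb d x ∘ (zhom ⊗' idm x) = (idm x ⊗' zhom) ∘ hb c x
}.

Lemma center_hom_eq (c d : center_ob) (f g : center_hom c d) :
  zhom f = zhom g -> f = g.
Proof.
case: f g => [f Hf] [g Hg] /= E; subst g.
by congr CenterHom; apply: proof_irrelevance.
Qed.

Program Definition center_id (c : center_ob) : center_hom c c :=
  @CenterHom c c (idm (zob c)) _.
Next Obligation. by rewrite !tensm1 comp1m compm1. Qed.

Program Definition center_comp (c d e : center_ob) (g : center_hom d e)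
    (f : center_hom c d) : center_hom c e :=
  @CenterHom c e (zhom g ∘ zhom f) _.
Next Obligation.
have -> : (g ∘ f) ⊗' idm x = (g ⊗' idm x) ∘ (f ⊗' idm x).
  by rewrite -tensmM comp1m.
have -> : idm x ⊗' (g ∘ f) = (idm x ⊗' g) ∘ (idm x ⊗' f).
  by rewrite -tensmM comp1m.
by rewrite compA zhom_hb -compA zhom_hb compA.
Qed.

Program Definition center : category :=
  @Category center_ob center_hom center_id center_comp _ _ _.
Next Obligation. by apply: center_hom_eq; rewrite /= comp1m. Qed.
Next Obligation. by apply: center_hom_eq; rewrite /= compm1. Qed.
Next Obligation. by apply: center_hom_eq; rewrite /= compA. Qed.

Lemma hb_unit (c : center_ob) : lunit c ∘ hb c one = runit c.
Proof.
have faith (x y : C) (f g : hom x y) :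
    f ⊗' idm one = g ⊗' idm (one : C) -> f = g.
  by move=> E; apply: (iso_epi (i := runit x)); rewrite -!runit_nat E.
apply: faith; apply: (iso_mono (i := hb c one)).
have kelly (x y : C) : lunit (x ⊗ y) ∘ assoc one x y = lunit x ⊗' idm y.
  exact: (@munit_massoc regular_module x y).
rewrite -tens_triangle [RHS]compA hb_nat -kelly.
have -> : (lunit c ∘ hb c one) ⊗' idm one =
          (lunit c ⊗' idm one) ∘ (hb c one ⊗' idm one).
  by rewrite -tensmM comp1m.
rewrite -kelly -!compA (compA (assoc _ _ _) (hb c _)) hb_hexagon.
by rewrite !compA -lunit_nat.
Qed.

(* The module functor c ▷ -, with constraint
   c ▷ (x ▷ m) ≅ (c ⊗ x) ▷ m ≅ (x ⊗ c) ▷ m ≅ x ▷ (c ▷ m). *)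
Program Definition center_act_mf (M : linear_module_category C)
    (c : center_ob) : module_functor M M :=
  @ModuleFunctor M M (act_functorr M c) _
    (fun x m => iso_comp (massoc x c m)
       (iso_comp (iso_act (hb c x) (iso_id m)) (iso_sym (massoc c x m))))
    _ _ _.
Next Obligation. by move=> x y; apply: actm_linearr. Qed.
Next Obligation.
apply: (iso_epi (i := massoc c x m)); rewrite -!compA -massoc_nat fwdK compm1.
rewrite (compA (bwd _)) fwdK comp1m -actmM comp1m hb_nat.
have -> : ((f ⊗' idm c) ∘ hb c x) ▷' g = ((f ⊗' idm c) ▷' g) ∘ (hb c x ▷' idm m).
  by rewrite -actmM compm1.
by rewrite compA massoc_nat compA.
Qed.
Next Obligation.
apply: (iso_epi (i := massoc c (x ⊗ y) m)).
apply: (iso_epi (i := iso_act (assoc c x y) (iso_id m))) => /=.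
transitivity ((idm x ▷' massoc y c m) ∘ massoc x (y ⊗ c) m ∘
    (((idm x ⊗' hb c y) ∘ assoc x c y ∘ (hb c x ⊗' idm y)) ▷' idm m)).
  rewrite -hb_hexagon !actm_compl !compA -act_pentagon.
  by rewrite -!compA (compA (bwd _)) fwdK comp1m.
have reassoc (p q r s t u : M) (f1 : hom t u) (f2 : hom s t) (f3 : hom r s)
    (f4 : hom q r) (f5 : hom p q) :
    f1 ∘ f2 ∘ f3 ∘ f4 ∘ f5 = f1 ∘ (f2 ∘ (f3 ∘ f4 ∘ f5)) by rewrite !compA.
rewrite [RHS]reassoc -act_pentagon -!compA (compA (bwd _)) fwdK comp1m.
rewrite -[in RHS](actm1 y m) -massoc_nat (compA (massoc x c _)) act_pentagon.
rewrite !actm_compl -!compA (compA (massoc x _ _)) massoc_nat !compA.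
do 3 congr (_ ∘ _); rewrite -!actm_compr; congr (idm x ▷' _).
by rewrite -!compA fwdK compm1.
Qed.
Next Obligation.
rewrite -[idm c ▷' munit m](compm1 (_ ▷' _)) -(bwdK (massoc c one m)).
rewrite [RHS]compA act_triangle -hb_unit actm_compl -munit_massoc.
by rewrite !compA.
Qed.

Program Definition center_act_mnt (M : linear_module_category C)
    (c d : center_ob) (f : center_hom c d) :
    module_nat_trans (center_act_mf M c) (center_act_mf M d) :=
  mnt_build (center_act_mf M c) (center_act_mf M d)
    (fun m => zhom f ▷' idm m) _ _.
Next Obligation. by rewrite -!actmM !comp1m !compm1. Qed.
Next Obligation.
apply: (iso_epi (i := massoc c x m)); rewrite -!compA fwdK compm1.
rewrite -(actm1 x m) -massoc_nat (compA (bwd _)) fwdK comp1m.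
rewrite -actm_compl zhom_hb actm_compl compA massoc_nat.
by rewrite -!compA.
Qed.

Program Definition center_act (M : linear_module_category C) :
    functor center (module_fun_cat M M) :=
  @Functor center (module_fun_cat M M) (center_act_mf M)
    (@center_act_mnt M) _ _.
Next Obligation. by apply: mnt_eq => m /=; rewrite actm1. Qed.
Next Obligation. by apply: mnt_eq => m /=; rewrite actm_compl. Qed.

(* Psi_N takes values in C^*_N and Phi_M in C^*_M with the reversed tensor
   product.  The two assignments differ only in their tensor structure, so as
   functors they are given by the same formula; adjoints only depend on the
   underlying functor. *)
Definition Psi (N : linear_module_category C) :
  functor center (module_fun_cat N N) := center_act N.

Definition Phi (M : linear_module_category C) :
  functor center (module_fun_cat M M) := center_act M.

Section InternalNat.
Variables M N : linear_module_category C.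

(* The action z ▷ H = z ▷ H(-) of the center on Fun_C(M, N). *)
Definition fun_act (z : center) (H : module_functor M N) : module_functor M N :=
  mf_comp (Psi N z) H.

Definition fun_actm (z w : center) (H K : module_functor M N)
    (f : hom z w) (t : module_nat_trans H K) :
    module_nat_trans (fun_act z H) (fun_act w K) :=
  mnt_hcomp (fhom (Psi N) f) t.

Record internal_nat (H H' : module_functor M N) := InternalNat {
  inat :> center;
  inat_hom : forall z : center,
    module_nat_trans (fun_act z H) H' -> hom z inat;
  inat_inv : forall z : center,
    hom z inat -> module_nat_trans (fun_act z H) H';
  inat_homK : forall z, cancel (@inat_hom z) (@inat_inv z);
  inat_invK : forall z, cancel (@inat_inv z) (@inat_hom z);
  inat_hom_nat : forall (w z : center) (g : hom w z)
    (t : module_nat_trans (fun_act z H) H'),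
    inat_hom (mnt_comp t (fun_actm g (mnt_id H))) = inat_hom t ∘ g
}.
Arguments inat_hom {H H'} _ {z} _.
Arguments inat_inv {H H'} _ {z} _.

Definition inat_ev (H H' : module_functor M N) (X : internal_nat H H') :
    module_nat_trans (fun_act X H) H' :=
  inat_inv X (idm (inat X)).

(* Functoriality, contravariant in the first and covariant in the second
   argument, as dictated by the universal property. *)
Definition inat_map (H K H' K' : module_functor M N)
    (X : internal_nat H H') (Y : internal_nat K K')
    (s : module_nat_trans K H) (s' : module_nat_trans H' K') :
    hom (inat X) (inat Y) :=
  inat_hom Y (mnt_comp s' (mnt_comp (inat_ev X) (fun_actm (idm (inat X)) s))).

End InternalNat.

End ModuleCategory.

(* Main.v *)
(* Maps z -> Phi^ra(H^ra H') are transformations z ▷ - => H^ra H', which transpose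
   to H(z ▷ -) => H' and, through the module structure of H, become
   z ▷ H(-) => H'.  Likewise maps z -> Psi^ra(H' H^la) are transformations
   z ▷ - => H' H^la, which transpose to z ▷ H(-) => H'.  So both objects are
   internal Homs from H to H', and Yoneda gives the isomorphisms; naturality
   holds because the maps that the universal property induces between these
   internal Homs are the adjoint functors applied to the mates. *)
From mathcomp Require Import all_boot all_algebra.
Require Import Defs.

Local Open Scope cat_scope.
Set Implicit Arguments.
Unset Strict Implicit.
Unset Printing Implicit Defensive.
#[local] Obligation Tactic := intros; simpl.

(** * Hom-set bijection of an adjunction between plain categories *)

Section Transpose.
Variables (A B : category) (F : functor A B) (G : functor B A).
Variable adj : adjunction F G.

Definition adj_transpose (x : A) (y : B) (f : hom (F x) y) : hom x (G y) :=
  fhom G f ∘ adj_unit adj x.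

Definition adj_untranspose (x : A) (y : B) (g : hom x (G y)) : hom (F x) y :=
  adj_counit adj y ∘ fhom F g.

Lemma adj_transposeK (x : A) (y : B) :
  cancel (@adj_transpose x y) (@adj_untranspose x y).
Proof.
move=> f; rewrite /adj_untranspose fhomM compA.
rewrite [_ ∘ fhom F (fhom G f)](nt_nat (adj_counit adj)) -compA.
by rewrite adj_triangle_l compm1.
Qed.

Lemma adj_untransposeK (x : A) (y : B) :
  cancel (@adj_untranspose x y) (@adj_transpose x y).
Proof.
move=> g; rewrite /adj_transpose fhomM -compA.
rewrite -[fhom G (fhom F g) ∘ _](nt_nat (adj_unit adj)) compA.
by rewrite adj_triangle_r comp1m.
Qed.

Lemma adj_transpose_compr (w x : A) (y : B) (f : hom (F x) y) (g : hom w x) :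
  adj_transpose (f ∘ fhom F g) = adj_transpose f ∘ g.
Proof.
rewrite /adj_transpose fhomM -compA.
by rewrite -[fhom G (fhom F g) ∘ _](nt_nat (adj_unit adj)) compA.
Qed.

Lemma adj_transpose_compl (x : A) (y z : B) (h : hom y z) (f : hom (F x) y) :
  adj_transpose (h ∘ f) = fhom G h ∘ adj_transpose f.
Proof. by rewrite /adj_transpose fhomM compA. Qed.

End Transpose.

Section ModuleTransformations.
Variables (k : fieldType) (C : monoidal_linear_category k).

(** Only the components have to be inverted: naturality and compatibility with the action pass from
    [t] to [u]. *)
Program Definition mnt_inv (M N : linear_module_category C)
    (H K : module_functor M N) (t : module_nat_trans H K)
    (u : forall m, hom (K m) (H m)) (tK : forall m, u m ∘ t m = idm (H m))
    (uK : forall m, t m ∘ u m = idm (K m)) : module_nat_trans K H :=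
  @mnt_build k C M N K H u _ _.
Next Obligation.
rewrite -[LHS]compm1 -(uK m) [LHS]compA -(compA (u n)) -nt_nat.
by rewrite (compA (u n)) tK comp1m.
Qed.
Next Obligation.
rewrite -[LHS]comp1m -(actm1 x (H m)) -(tK m) actm_compr -compA.
by rewrite (compA _ _ (u _)) -mnt_str -!compA uK compm1.
Qed.

(** Compares the two actions H(z ▷ -) and z ▷ H(-) of the center. It is a module transformation
    because the constraint of [H] is natural with respect to the half-braiding of [z]. *)
Program Definition act_mf_str (M N : linear_module_category C)
    (H : module_functor M N) (z : center C) :
    module_nat_trans (mf_comp H (center_act M z)) (fun_act z H) :=
  @mnt_build k C M N (mf_comp H (center_act M z)) (fun_act z H)
    (fun m => mf_str H z m) _ _.
Next Obligation. by rewrite mf_str_nat. Qed.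
Next Obligation.
(* After this precomposition the pentagon of [H] applies on both sides, for [z ⊗ x] and [x ⊗ z];
   they then differ by moving [hb z x] past [mf_str H]. *)
apply: (iso_epi (i := iso_fun H (massoc z x m))) => /=.
rewrite !fhomM -!compA -fhomM fwdK fhom1 compm1.
rewrite (compA (idm x ▷' _)) (compA (_ ∘ mf_str H x _)) -mf_pentagon.
rewrite (compA (idm z ▷' _)) -mf_pentagon (compA (bwd _)) fwdK comp1m.
by rewrite -!compA mf_str_nat fhom1.
Qed.

(** * Transposition of module transformations along a module adjunction *)

Section Transposition.
Variables (M N P : linear_module_category C).
Variables (F : module_functor M N) (G : module_functor N M).
Variable adj : module_adjunction F G.

Program Definition transpose_post (A : module_functor P M)
    (B : module_functor P N) (t : module_nat_trans (mf_comp F A) B) :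
    module_nat_trans A (mf_comp G B) :=
  @mnt_build k C P M A (mf_comp G B)
    (fun p => fhom G (t p) ∘ madj_unit adj (A p)) _ _.
Next Obligation.
rewrite -compA [_ ∘ fhom A f](nt_nat (madj_unit adj) (fhom A f)) /=.
by rewrite !compA -!fhomM -(nt_nat t).
Qed.
Next Obligation.
have eta := mnt_str (madj_unit adj) x (A m).
rewrite /= compm1 in eta.
rewrite actm_compr -(compA _ _ (mf_str A x m)) -eta.
rewrite !compA -mf_str_nat.
rewrite -!compA; congr (_ ∘ _); rewrite (compA (fhom G _)) -fhomM (mnt_str t) /=.
by rewrite !fhomM -!compA -(nt_nat (madj_unit adj)).
Qed.

Program Definition untranspose_post (A : module_functor P M)
    (B : module_functor P N) (u : module_nat_trans A (mf_comp G B)) :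
    module_nat_trans (mf_comp F A) B :=
  @mnt_build k C P N (mf_comp F A) B
    (fun p => madj_counit adj (B p) ∘ fhom F (u p)) _ _.
Next Obligation.
rewrite -compA -fhomM (nt_nat u) fhomM compA.
by rewrite [_ ∘ fhom F (fhom G _)](nt_nat (madj_counit adj)) -compA.
Qed.
Next Obligation.
have eps := mnt_str (madj_counit adj) x (B m).
rewrite /= comp1m in eps.
rewrite actm_compr -compA (compA (idm x ▷' fhom F _)) -mf_str_nat.
rewrite -(compA (mf_str F x _)) -fhomM -(mnt_str u) /= !fhomM.
rewrite (compA _ (mf_str F x _)) !compA -(compA _ (mf_str F x _)) -eps.
by rewrite [_ ∘ fhom F (fhom G _)](nt_nat (madj_counit adj)).
Qed.

Lemma transpose_postK (A : module_functor P M) (B : module_functor P N) :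
  cancel (@transpose_post A B) (@untranspose_post A B).
Proof.
move=> t; apply: mnt_eq => p /=.
rewrite fhomM compA [_ ∘ fhom F (fhom G _)](nt_nat (madj_counit adj)) -compA.
by rewrite madj_triangle_l compm1.
Qed.

Lemma untranspose_postK (A : module_functor P M) (B : module_functor P N) :
  cancel (@untranspose_post A B) (@transpose_post A B).
Proof.
move=> u; apply: mnt_eq => p /=.
rewrite fhomM -compA -[fhom G (fhom F _) ∘ _](nt_nat (madj_unit adj)) compA.
by rewrite madj_triangle_r comp1m.
Qed.

(** Precomposition reverses the adjunction: for F ⊣ G, the functor - ∘ G is left adjoint to - ∘
    F. *)
Program Definition transpose_pre (A : module_functor M P)
    (B : module_functor N P) (t : module_nat_trans (mf_comp A G) B) :
    module_nat_trans A (mf_comp B F) :=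
  @mnt_build k C M P A (mf_comp B F)
    (fun m => t (F m) ∘ fhom A (madj_unit adj m)) _ _.
Next Obligation.
rewrite -compA -fhomM [_ ∘ f](nt_nat (madj_unit adj)) /= fhomM !compA.
by rewrite -(nt_nat t).
Qed.
Next Obligation.
have eta := mnt_str (madj_unit adj) x m.
rewrite /= compm1 in eta.
rewrite actm_compr -(compA _ _ (mf_str A x m)) -mf_str_nat -eta !fhomM.
rewrite -!compA (compA (fhom B _)) -(nt_nat t) /=.
by rewrite !compA (mnt_str t) /= !compA.
Qed.

Program Definition untranspose_pre (A : module_functor M P)
    (B : module_functor N P) (u : module_nat_trans A (mf_comp B F)) :
    module_nat_trans (mf_comp A G) B :=
  @mnt_build k C N P (mf_comp A G) B
    (fun n => fhom B (madj_counit adj n) ∘ u (G n)) _ _.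
Next Obligation.
rewrite -compA (nt_nat u) /= !compA -!fhomM.
by rewrite [_ ∘ fhom F (fhom G _)](nt_nat (madj_counit adj)).
Qed.
Next Obligation.
have eps := mnt_str (madj_counit adj) x m.
rewrite /= comp1m in eps.
rewrite actm_compr -compA (compA (idm x ▷' u _)) -(mnt_str u) /=.
rewrite -!compA (nt_nat u) /= !compA -mf_str_nat -!compA eps !fhomM.
by rewrite !compA.
Qed.

Lemma transpose_preK (A : module_functor M P) (B : module_functor N P) :
  cancel (@transpose_pre A B) (@untranspose_pre A B).
Proof.
move=> t; apply: mnt_eq => n /=.
by rewrite compA -(nt_nat t) /= -compA -fhomM madj_triangle_r fhom1 compm1.
Qed.

Lemma untranspose_preK (A : module_functor M P) (B : module_functor N P) :
  cancel (@untranspose_pre A B) (@transpose_pre A B).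
Proof.
move=> u; apply: mnt_eq => m /=.
by rewrite -compA (nt_nat u) /= compA -fhomM madj_triangle_l fhom1 comp1m.
Qed.

End Transposition.
End ModuleTransformations.

(** * Yoneda for internal natural transformations *)

Section InternalNat.
Variables (k : fieldType) (C : monoidal_linear_category k).
Variables M N : linear_module_category C.

(** Yoneda: by naturality in [z], the bijection is determined by the image [inat_ev X] of the
    identity. *)
Lemma inat_invE (H H' : module_functor M N) (X : internal_nat H H')
    (z : center C) (g : hom z X) :
  inat_inv g = mnt_comp (inat_ev X) (fun_actm g (mnt_id H)).
Proof.
rewrite -[RHS](inat_homK X) (inat_hom_nat X) inat_invK; congr inat_inv.
by rewrite [RHS]comp1m.
Qed.

Lemma inat_map_id (H H' : module_functor M N) (X : internal_nat H H') :
  inat_map X X (mnt_id H) (mnt_id H') = idm (inat X).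
Proof.
rewrite -[RHS](inat_invK (idm (inat X))) inat_invE /inat_map; congr (inat_hom X).
by apply: mnt_eq => m /=; rewrite comp1m.
Qed.

Lemma inat_map_comp (H K L H' K' L' : module_functor M N)
    (X : internal_nat H H') (Y : internal_nat K K') (W : internal_nat L L')
    (s : module_nat_trans K H) (r : module_nat_trans L K)
    (s' : module_nat_trans H' K') (r' : module_nat_trans K' L') :
  inat_map Y W r r' ∘ inat_map X Y s s' =
  inat_map X W (mnt_comp s r) (mnt_comp r' s').
Proof.
rewrite {1}/inat_map -inat_hom_nat; congr (inat_hom W).
(* The characterization of [inat_map X Y s s']: acting through it and evaluating with [Y] gives back
   the transformation that defines it. The rest is bifunctoriality of the action. *)
have ev_map := inat_homK Y (mnt_comp s' (mnt_comp (inat_ev X)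
  (fun_actm (idm (inat X)) s))).
rewrite -/(inat_map X Y s s') inat_invE in ev_map.
apply: mnt_eq => m /=.
have := congr1 (fun t : module_nat_trans _ _ => t m) ev_map => /= {}ev_map.
rewrite !actm1 !comp1m compm1 in ev_map.
rewrite !actm1 !comp1m compm1 actm_compr -[RHS]compA.
rewrite [in RHS](compA (inat_ev X m)) [in RHS](compA (s' m)) -ev_map.
by rewrite -!compA -!actmM !comp1m !compm1.
Qed.

Lemma mnt_comp1 (H K : module_functor M N) (t : module_nat_trans H K) :
  mnt_comp t (mnt_id H) = t.
Proof. exact: (@compm1 (module_fun_cat M N)). Qed.

Lemma mnt_1comp (H K : module_functor M N) (t : module_nat_trans H K) :
  mnt_comp (mnt_id K) t = t.
Proof. exact: (@comp1m (module_fun_cat M N)). Qed.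

Program Definition inat_iso (H H' : module_functor M N)
    (X Y : internal_nat H H') : iso (inat X) (inat Y) :=
  @Iso (center C) _ _ (inat_map X Y (mnt_id H) (mnt_id H'))
    (inat_map Y X (mnt_id H) (mnt_id H')) _ _.
Next Obligation. by rewrite inat_map_comp !mnt_comp1 inat_map_id. Qed.
Next Obligation. by rewrite inat_map_comp !mnt_comp1 inat_map_id. Qed.

(** By functoriality both composites are [inat_map X Y' s s'], whatever representing objects are
    chosen. *)
Lemma inat_iso_nat (H K H' K' : module_functor M N)
    (X X' : internal_nat H H') (Y Y' : internal_nat K K')
    (s : module_nat_trans K H) (s' : module_nat_trans H' K') :
  inat_iso Y Y' ∘ inat_map X Y s s' = inat_map X' Y' s s' ∘ inat_iso X X'.
Proof. by rewrite !inat_map_comp !mnt_comp1 !mnt_1comp. Qed.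

(** * Internal Homs obtained from a right adjoint of the center action *)

Section AdjointRepresentation.
Variables (P : linear_module_category C) (R : right_adjoint (center_act P)).

Section Construction.
Variables (H H' : module_functor M N) (T : module_functor P P).
Variable tr : forall z : center C,
  module_nat_trans (fun_act z H) H' -> module_nat_trans (center_act P z) T.
Variable untr : forall z : center C,
  module_nat_trans (center_act P z) T -> module_nat_trans (fun_act z H) H'.
Hypothesis trK : forall z, cancel (@tr z) (@untr z).
Hypothesis untrK : forall z, cancel (@untr z) (@tr z).
Hypothesis tr_nat : forall (w z : center C) (g : hom w z)
    (t : module_nat_trans (fun_act z H) H'),
  tr (mnt_comp t (fun_actm g (mnt_id H))) =
  mnt_comp (tr t) (fhom (center_act P) g).

(** Kept transparent: later statements use that the underlying object is [R T] by conversion.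
    Leaving [P] general covers both [P] = [M] and [P] = [N]. *)
Definition inat_of_adjoint : internal_nat H H'.
Proof.
refine (@InternalNat k C M N H H' (R T)
  (fun z t => adj_transpose (radj_adj R) (tr t))
  (fun z g => untr (adj_untranspose (radj_adj R) g)) _ _ _).
- by move=> z t; rewrite adj_transposeK trK.
- by move=> z g; rewrite untrK adj_untransposeK.
- by move=> w z g t; rewrite tr_nat -adj_transpose_compr.
Defined.

End Construction.

(** The hypothesis, taken at [inat_ev], turns the induced map into the transpose of [theta] after
    [trH] of the evaluation. [R] pulls [theta] out, and what remains is the transpose of an
    untransposed identity. *)
Lemma inat_map_of_adjoint (H K H' K' : module_functor M N)
    (T U : module_functor P P) trH untrH trHK untrHK trH_nat
    trK untrK trKK untrKK trK_nat
    (s : module_nat_trans K H) (s' : module_nat_trans H' K')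
    (theta : module_nat_trans T U) :
  (forall (z : center C) (t : module_nat_trans (fun_act z H) H'),
     trK z (mnt_comp s' (mnt_comp t (fun_actm (idm z) s))) =
     mnt_comp theta (trH z t)) ->
  inat_map (@inat_of_adjoint H H' T trH untrH trHK untrHK trH_nat)
    (@inat_of_adjoint K K' U trK untrK trKK untrKK trK_nat) s s' =
  fhom R theta.
Proof.
move=> E; rewrite /inat_map [LHS]/= E.
rewrite [LHS](adj_transpose_compl (radj_adj R)) /inat_ev /inat_inv /=.
by rewrite untrHK adj_untransposeK compm1.
Qed.

End AdjointRepresentation.

(** * Representation by H^ra H' *)

Section RightAdjoint.
Variable R : right_adjoint (center_act M).

(** The source z ▷ H(-) is first replaced by H(z ▷ -), so that [H] is outermost and H ⊣ H^ra
    applies. *)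
Definition inat_ra (H H' : module_functor M N) (G : module_right_adjoint H) :
  internal_nat H H'.
Proof.
refine (@inat_of_adjoint M R H H' (mf_comp G H')
  (fun z t => transpose_post (mra_adj G) (mnt_comp t (act_mf_str H z)))
  (fun z u => mnt_comp (untranspose_post (mra_adj G) u)
     (mnt_inv (t := act_mf_str H z) (fun m => fwdK (mf_str H z m))
       (fun m => bwdK (mf_str H z m)))) _ _ _).
- move=> z t; rewrite transpose_postK; apply: mnt_eq => m /=.
  by rewrite -compA bwdK compm1.
- move=> z u; rewrite -[RHS](untranspose_postK (mra_adj G)).
  congr transpose_post; apply: mnt_eq => m /=.
  by rewrite -compA fwdK compm1.
- move=> w z g t; apply: mnt_eq => m /=.
  rewrite actm1 compm1 -[RHS]compA.
  rewrite [in RHS](nt_nat (madj_unit (mra_adj G)) (g ▷' idm m)) /=.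
  by rewrite [RHS]compA -fhomM -[in RHS](compA (t m)) mf_str_nat fhom1 compA.
Defined.

Lemma inat_map_ra (H K H' K' : module_functor M N)
    (Hra : module_right_adjoint H) (Kra : module_right_adjoint K)
    (s : module_nat_trans K H) (s' : module_nat_trans H' K') :
  inat_map (inat_ra H' Hra) (inat_ra K' Kra) s s' =
  fhom R (mnt_hcomp (mate_ra Hra Kra s) s').
Proof.
apply: inat_map_of_adjoint => z t; apply: mnt_eq => m /=.
rewrite actm1 comp1m -[RHS]compA [in RHS](compA (fhom Hra (s' m))) -fhomM.
(* Moving the unit of K ⊣ K^ra to the far right makes both sides K^ra of a morphism after that unit,
   so the morphisms can be compared. *)
have eta (p q : M) (f : hom p q) : madj_unit (mra_adj Kra) q ∘ f =
  fhom Kra (fhom K f) ∘ madj_unit (mra_adj Kra) p.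
  exact: (nt_nat (madj_unit (mra_adj Kra)) f).
rewrite -[RHS]compA eta [RHS]compA -!fhomM; congr (fhom Kra _ ∘ _).
rewrite -[RHS]compA (nt_nat s) fhomM !compA.
rewrite [_ ∘ fhom H (fhom Hra _)](nt_nat (madj_counit (mra_adj Hra))) /=.
(* The counit of H ⊣ H^ra from the mate cancels the unit from the transposition. *)
rewrite -(compA _ _ (fhom H _)) madj_triangle_l compm1.
by rewrite -!compA (mnt_str s).
Qed.

End RightAdjoint.

(** * Representation by H' H^la *)

Section LeftAdjoint.
Variable R : right_adjoint (center_act N).

(** [fun_act z H] is by definition [center_act N z] precomposed with [H], so transposition along
    H^la ⊣ H applies directly. *)
Definition inat_la (H H' : module_functor M N) (L : module_left_adjoint H) :
  internal_nat H H'.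
Proof.
refine (@inat_of_adjoint N R H H' (mf_comp H' L)
  (fun z t => transpose_pre (mla_adj L) t)
  (fun z u => untranspose_pre (mla_adj L) u) _ _ _).
- by move=> z t; rewrite transpose_preK.
- by move=> z u; rewrite untranspose_preK.
- move=> w z g t; apply: mnt_eq => n /=.
  by rewrite actm1 compm1 -!compA -!actmM !comp1m !compm1.
Defined.

Lemma inat_map_la (H K H' K' : module_functor M N)
    (Hla : module_left_adjoint H) (Kla : module_left_adjoint K)
    (s : module_nat_trans K H) (s' : module_nat_trans H' K') :
  inat_map (inat_la H' Hla) (inat_la K' Kla) s s' =
  fhom R (mnt_hcomp s' (mate_la Hla Kla s)).
Proof.
apply: inat_map_of_adjoint => z t; apply: mnt_eq => n /=.
rewrite actm1 comp1m -[RHS]compA [in RHS](compA (fhom H' _)) -(nt_nat t) /=.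
rewrite -!compA -!actm_compr; do 2 congr (_ ∘ _); congr (_ ▷' _).
(* What is left is the defining property of the mate: its transpose under H^la ⊣ H is [s] after the
   unit of K^la ⊣ K. *)
rewrite -fhomM fhomM -compA.
rewrite -[fhom H (fhom Hla _) ∘ _](nt_nat (madj_unit (mla_adj Hla))) compA.
by rewrite madj_triangle_r comp1m.
Qed.

End LeftAdjoint.
End InternalNat.

Theorem lemma6p7 (k : closedFieldType) (C : monoidal_linear_category k)
    (finC : finite_tensor_category C)
    (M N : linear_module_category C)
    (exM : exact_module_category M) (exN : exact_module_category N)
    (Hra : forall H : module_functor M N, module_right_adjoint H)
    (Hla : forall H : module_functor M N, module_left_adjoint H)
    (Phi_ra : right_adjoint (Phi M)) (Psi_ra : right_adjoint (Psi N))
    (Nat : forall H H' : module_functor M N, internal_nat H H') :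
  exists (a : forall H H' : module_functor M N,
            iso (inat (Nat H H')) (Phi_ra (mf_comp (Hra H) H')))
         (b : forall H H' : module_functor M N,
            iso (Phi_ra (mf_comp (Hra H) H')) (Psi_ra (mf_comp H' (Hla H)))),
    forall (H K H' K' : module_functor M N)
      (s : module_nat_trans K H) (s' : module_nat_trans H' K'),
      a K K' ∘ inat_map (Nat H H') (Nat K K') s s' =
        fhom Phi_ra (mnt_hcomp (mate_ra (Hra H) (Hra K) s) s') ∘ a H H' /\
      b K K' ∘ fhom Phi_ra (mnt_hcomp (mate_ra (Hra H) (Hra K) s) s') =
        fhom Psi_ra (mnt_hcomp s' (mate_la (Hla H) (Hla K) s)) ∘ b H H'.
Proof.
(* [X] and [Y] make the two adjoint expressions internal Homs from [H] to [H'], so [a] and [b] are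
   comparisons of representing objects. *)
pose X H H' : internal_nat H H' := inat_ra Phi_ra H' (Hra H).
pose Y H H' : internal_nat H H' := inat_la Psi_ra H' (Hla H).
exists (fun H H' => inat_iso (Nat H H') (X H H')).
exists (fun H H' => inat_iso (X H H') (Y H H')) => H K H' K' s s'.
split.
  (* Once the adjoint applied to mates is read as [inat_map], the square is an instance of
     [inat_iso_nat]. *)
  rewrite -inat_map_ra.
  exact: (inat_iso_nat (Nat H H') (X H H') (Nat K K') (X K K') s s').
rewrite -inat_map_ra -inat_map_la.
exact: (inat_iso_nat (X H H') (Y H H') (X K K') (Y K K') s s').
Qed.
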